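(* Let $p, q, r, s$ be arbitrary integers. Let $(a_1,a_2,a_3)$ and $(b_1,b_2,b_3)$ be the two triples of integers defined in any one of the following three ways: (i) \[ \begin{aligned} a_1 & = 0, \\ a_2 & = 16pqrs, \\ a_3 & = (p+q+r+s)(p+q-r-s)(p-q+r-s)(p-q-r+s), \\ b_1 & = 4(pr-qs)^2, \\ b_2 & = 4(ps-qr)^2, \\ b_3 & = 4(pq-rs)^2; \end{aligned} \] (ii) \[ \begin{aligned} a_1 & = -(p+q+r+s)(p+q-r-s)(p-q+r-s)(p-q-r+s), \\ a_2 & = -(p-q+r+s)(p-q-r-s)(p+q+r-s)(p+q-r+s), \\ a_3 & = 0, \\ b_1 & = (p^2-q^2+r^2-s^2)^2, \\ b_2 & = (p^2-q^2-r^2+s^2)^2, \\ b_3 & = (p^2+q^2-r^2-s^2)^2; \end{aligned} \] (iii) \[ \begin{aligned} a_1 & = 4(ps-qr)^2, \\ a_2 & = 4(ps+qr)^2, \\ a_3 & = (p^2-q^2-r^2+s^2)^2, \\ b_1 & = 4(p^2-q^2)(r^2-s^2), \\ b_2 & = 0, \\ b_3 & = 4(p^2-r^2)(q^2-s^2). \end{aligned} \] Then, in each of the three cases, all the nine sums $a_i+b_j$, $i=1,2,3$, $j=1,2,3$, are perfect squares.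
   Context: A perfect square is the square of an integer. *)

(* Defs.v *)
From mathcomp Require Import all_boot all_order all_algebra.

Set Implicit Arguments.
Unset Strict Implicit.
Unset Printing Implicit Defensive.

Import GRing.Theory Num.Theory.
Local Open Scope ring_scope.

Definition perfect_square (n : int) : Prop := exists k : int, n = k ^+ 2.

Definition triples_i (p q r s : int) (a b : 3.-tuple int) : Prop :=
  a = [tuple 0;
             16 * p * q * r * s;
             (p + q + r + s) * (p + q - r - s) * (p - q + r - s)
               * (p - q - r + s)]
  /\
  b = [tuple 4 * (p * r - q * s) ^+ 2;
             4 * (p * s - q * r) ^+ 2;
             4 * (p * q - r * s) ^+ 2].

Definition triples_ii (p q r s : int) (a b : 3.-tuple int) : Prop :=
  a = [tuple - ((p + q + r + s) * (p + q - r - s) * (p - q + r - s)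
                  * (p - q - r + s));
             - ((p - q + r + s) * (p - q - r - s) * (p + q + r - s)
                  * (p + q - r + s));
             0]
  /\
  b = [tuple (p ^+ 2 - q ^+ 2 + r ^+ 2 - s ^+ 2) ^+ 2;
             (p ^+ 2 - q ^+ 2 - r ^+ 2 + s ^+ 2) ^+ 2;
             (p ^+ 2 + q ^+ 2 - r ^+ 2 - s ^+ 2) ^+ 2].

Definition triples_iii (p q r s : int) (a b : 3.-tuple int) : Prop :=
  a = [tuple 4 * (p * s - q * r) ^+ 2;
             4 * (p * s + q * r) ^+ 2;
             (p ^+ 2 - q ^+ 2 - r ^+ 2 + s ^+ 2) ^+ 2]
  /\
  b = [tuple 4 * (p ^+ 2 - q ^+ 2) * (r ^+ 2 - s ^+ 2);
             0;
             4 * (p ^+ 2 - r ^+ 2) * (q ^+ 2 - s ^+ 2)].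

(* Main.v *)
Require Import Defs.
From mathcomp Require Import all_boot all_order all_algebra.
From mathcomp Require Import ring.

(** The square root of [a_i + b_j] is given by the same formula in all three
    cases: [j] selects a splitting of [{p, q, r, s}] into two pairs, for instance
    [{p, r}] and [{q, s}] when [j = 1], and the roots for [i = 1, 2, 3] are then
    [2(pr - qs)], [2(pr + qs)] and [p^2 + r^2 - q^2 - s^2]. *)

Local Open Scope ring_scope.

Lemma forall_ord3 (P : 'I_3 -> Prop) :
  P ord0 -> P (lift ord0 ord0) -> P (lift ord0 (lift ord0 ord0)) ->
  forall i, P i.
Proof.
move=> P0 P1 P2 i; case: (unliftP ord0 i) => [j ->|-> //].
case: (unliftP ord0 j) => [k ->|-> //].
by rewrite (ord1 k).
Qed.

Theorem theorem1 (p q r s : int) (a b : 3.-tuple int)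
    (hab : triples_i p q r s a b \/ triples_ii p q r s a b
           \/ triples_iii p q r s a b)
    (i j : 'I_3) :
  perfect_square (tnth a i + tnth b j).
Proof.
(* The 27 goals come ordered by [i], then [j], then case, so each consecutive three are one sum
   [a_i + b_j] in the three cases. *)
move: i j; apply: forall_ord3; apply: forall_ord3;
  case: hab => [[-> ->]|[[-> ->]|[-> ->]]]; rewrite !(tnth_nth 0) /=.
1-3: by exists (2 * (p * r - q * s)); ring.
1-3: by exists (2 * (p * s - q * r)); ring.
1-3: by exists (2 * (p * q - r * s)); ring.
(* In every case [a_2 - a_1 = 16pqrs], which equals [4(pr + qs)^2 - 4(pr - qs)^2] and its analogue
   for each splitting. *)
1-3: by exists (2 * (p * r + q * s)); ring.
1-3: by exists (2 * (p * s + q * r)); ring.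
1-3: by exists (2 * (p * q + r * s)); ring.
(* In every case [a_3 - a_1] is the product of four linear factors in (i), symmetric in
   [p, q, r, s]; [(p^2 + r^2 - q^2 - s^2)^2 - 4(pr - qs)^2] factors into it. *)
1-3: by exists (p ^+ 2 - q ^+ 2 + r ^+ 2 - s ^+ 2); ring.
1-3: by exists (p ^+ 2 - q ^+ 2 - r ^+ 2 + s ^+ 2); ring.
1-3: by exists (p ^+ 2 + q ^+ 2 - r ^+ 2 - s ^+ 2); ring.
Qed.
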